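(* Let $m>1$ be a real number. There exist constants $C_1(m),C_2(m)>0$, depending only on $m$, such that for every even integer $N>0$, every real $\lambda>0$ and every $l\in\{1,\dots,N\}$ the tridiagonal matrix $L^l_\lambda$ satisfies $$\|(L^l_\lambda)^{-1}\|_{l^1\to l^1}\le C_1(m)\Big(\frac{l\lambda}{2}\Big)^{-1+\frac1{2m}},\qquad \|(L^l_\lambda)^{-1}\|_{l^1\to l^\infty}\le 2^{2m}\Big(\frac{l\lambda}{2}\Big)^{-1},\qquad \|(L^l_\lambda)^{-1}\|_{l^1\to l^1_1}\le C_2(m)\Big(\frac{l\lambda}{2}\Big)^{-1+\frac1{m}},$$ and the block-diagonal matrix $L^R_\lambda$ satisfies $$\|(L^R_\lambda)^{-1}\|_{l^1\to l^1}\le C_1(m)\Big(\frac{\lambda}{2}\Big)^{-1+\frac1{2m}},\qquad \|(L^R_\lambda)^{-1}\|_{l^1\to l^\infty}\le 2^{2m}\Big(\frac{\lambda}{2}\Big)^{-1},\qquad \|(L^R_\lambda)^{-1}\|_{l^1\to l^1_1}\le C_2(m)\Big(\frac{\lambda}{2}\Big)^{-1+\frac1{m}}.$$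
   Context: For $l\in\{1,\dots,N\}$, $L^l_\lambda\in\mathbb{R}^{N\times N}$ is the tridiagonal matrix with diagonal entries $(L^l_\lambda)_{jj}=l^{2m}+(j-1)^{2m}$, $j=1,\dots,N$, superdiagonal entries $(L^l_\lambda)_{j,j+1}=-\frac{l\lambda}{2}$ and subdiagonal entries $(L^l_\lambda)_{j+1,j}=\frac{l\lambda}{2}$, $j=1,\dots,N-1$, all other entries being zero. $L^R_\lambda\in\mathbb{R}^{N^2\times N^2}$ is the block-diagonal matrix with diagonal blocks $L^1_\lambda,L^2_\lambda,\dots,L^N_\lambda$. (These are finite-dimensional truncations of the operator $w\mapsto\lambda\sin y\,\partial_xw+(-\Delta)^mw$, in the basis $\sin(lx+ky)$.) All these matrices are invertible. Norms: $\|A\|_{l^1\to l^1}=\max_j\sum_k|A_{kj}|$ and $\|A\|_{l^1\to l^\infty}=\max_{j,k}|A_{kj}|$. The gradient norm: for a block-diagonal matrix $A$ with $N\times N$ blocks $A_1,\dots,A_N$, $$\|A\|_{l^1\to l^1_1}=\max_{1\le l\le N,\ 1\le j\le N}\ \sum_{k=1}^N(l+k)\,|(A_l)_{kj}|,$$ and for a single block with index $l$, $\|A_l\|_{l^1\to l^1_1}=\max_{1\le j\le N}\sum_{k=1}^N(l+k)|(A_l)_{kj}|$. *)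

(* Defs.v *)
From HB Require Import structures.
From mathcomp Require Import all_boot all_order all_algebra.
From mathcomp Require Import all_classical all_reals all_analysis.
Set Implicit Arguments.
Unset Strict Implicit.
Unset Printing Implicit Defensive.
Import Order.TTheory GRing.Theory Num.Theory.
Local Open Scope ring_scope.

(* Indices j in {1, ..., N} are represented by j : 'I_N with value j - 1.
   In particular (j - 1)^{2m} reads j%:R `^ (2 * m); the entry for j = 1 is
   0 `^ (2 * m), which is 0 whenever m != 0. *)
Definition Lblock (R : realType) (N : nat) (m lambda : R) (l : nat) : 'M[R]_N :=
  \matrix_(i < N, j < N)
    if (i : nat) == j then l%:R `^ (2 * m) + j%:R `^ (2 * m)
    else if (j : nat) == i.+1 then - (l%:R * lambda / 2)
    else if (i : nat) == j.+1 then l%:R * lambda / 2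
    else 0.

(* The dimension \sum_(l < N) N is N ^ 2. *)
Definition LR (R : realType) (N : nat) (m lambda : R) :
    'M[R]_(\sum_(l < N) N) :=
  \mxdiag_(l < N) Lblock N m lambda l.+1.

(* All the maxima below are over nonnegative quantities, so that the default
   value 0 is harmless. *)
Definition norm_l1_l1 (R : realType) (n : nat) (A : 'M[R]_n) : R :=
  \big[Num.max/0]_(j < n) \sum_(k < n) `|A k j|.

Definition norm_l1_linfty (R : realType) (n : nat) (A : 'M[R]_n) : R :=
  \big[Num.max/0]_(j < n) \big[Num.max/0]_(k < n) `|A k j|.

Definition norm_l1_l11_block (R : realType) (N l : nat) (A : 'M[R]_N) : R :=
  \big[Num.max/0]_(j < N) \sum_(k < N) (l + k.+1)%:R * `|A k j|.

Definition norm_l1_l11 (R : realType) (N : nat)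
    (A : 'M[R]_(\sum_(l < N) N)) : R :=
  \big[Num.max/0]_(l < N) norm_l1_l11_block l.+1 (submxblock A l l).

(* The matrices are invertible, so that invmx is a genuine inverse. *)
Lemma Lblock_unitmx (R : realType) (N : nat) (m lambda : R) (l : nat) :
  (0 < l)%N -> Lblock N m lambda l \in unitmx.
Proof.
move=> l0; rewrite -row_free_unit; apply/inj_row_free => v vL0.
pose d : 'rV[R]_N := \row_j (l%:R `^ (2 * m) + j%:R `^ (2 * m)).
pose S := Lblock N m lambda l - diag_mx d.
have ST : S^T = - S.
  apply/matrixP => i j; rewrite !mxE (eq_sym (j : nat) i) (eq_sym j i).
  rewrite -[i == j]/((i : nat) == j).
  case: (eqVneq (i : nat) j) => [/ord_inj ->|ij].
    by rewrite !mulr1n subrr oppr0.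
  rewrite !mulr0n !subr0.
  case: eqP => [e1|_]; case: eqP => [e2|_]; rewrite ?opprK ?oppr0 //.
  by move: e2; rewrite e1 => /eqP; rewrite -addn2 -[X in X == _]addn0 eqn_add2l.
have s0 : (v *m S *m v^T) 0 0 = 0.
  have : (v *m S *m v^T)^T 0 0 = - (v *m S *m v^T) 0 0.
    by rewrite !trmx_mul trmxK ST mulNmx mulmxN mulmxA mxE.
  by rewrite mxE => /eqP; rewrite -addr_eq0 -mulr2n mulrn_eq0 /= => /eqP.
have dpos j : 0 < d 0 j.
  by rewrite mxE ltr_pwDl ?powR_ge0 // powR_gt0 // ltr0n.
have q0 : \sum_j d 0 j * v 0 j ^+ 2 = 0.
  have : (v *m Lblock N m lambda l *m v^T) 0 0 = 0 by rewrite vL0 mul0mx mxE.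
  rewrite -[Lblock N m lambda l](subrK (diag_mx d)) -/S mulmxDr mulmxDl.
  rewrite mxE s0 add0r mxE => q0; rewrite -[RHS]q0; apply: eq_bigr => j _.
  by rewrite mul_mx_diag !mxE expr2 mulrCA mulrA.
apply/rowP => j; rewrite mxE; apply/eqP.
have /psumr_eq0P -/(_ q0 j isT) : forall i : 'I_N, true ->
    0 <= d 0 i * v 0 i ^+ 2.
  by move=> i _; rewrite mulr_ge0 ?sqr_ge0 // ltW.
by move=> /eqP; rewrite mulf_eq0 gt_eqF //= expf_eq0.
Qed.

Lemma LR_unitmx (R : realType) (N : nat) (m lambda : R) :
  LR N m lambda \in unitmx.
Proof.
rewrite -row_free_unit /row_free rank_mxdiag; apply/eqP.
apply: eq_bigr => l _.
exact/mxrank_unit/Lblock_unitmx.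
Qed.

(* Main.v *)
Require Import Defs.
From mathcomp Require Import all_boot all_order all_algebra.
From mathcomp Require Import all_classical all_reals all_analysis.
From mathcomp Require Import ring lra zify.
Import Order.TTheory GRing.Theory Num.Theory.
Local Open Scope ring_scope.

(** Write [a = l * lambda / 2] and [d_j = l ^ 2m + (j - 1) ^ 2m], and let [w] be
column [q] of the inverse of block [l], so that
[d_j w_j - a w_(j+1) + a w_(j-1)] is [1] for [j = q] and [0] otherwise, with
[w_0 = w_(N+1) = 0].  Put [z = a w] and [e = d / a].

Because the off-diagonal part is antisymmetric, there is no cancellation in
this recurrence.  To the left of the peak it reads
[z_(k+1) = z_(k-1) + e_k z_k], so consecutive entries have the same sign.  To
the right of it, [(-1) ^ k z_(N+1-k)] satisfies a recurrence of the same shape,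
so the signs alternate.  In both cases [|z|] satisfies the recurrence as well
([two_step_rec_norm]); hence it is monotone in steps of two, and summing the
recurrence telescopes to a bound on the sum of [e_k |z_k|] by the last two terms
([two_step_rec_sum]).  The signs also agree in the equation at the peak, which
becomes the identity [e_q |z_q| + |z_(q-1)| + |z_(q+1)| = 1] ([green_flux]).

The neighbours of the peak are thus bounded by [1].  For the peak itself, put
[c = 2 ^ 2m], which bounds the growth [d_(k+1) / d_k].  The recurrence vanishes
at its starting point, and this forces the terms of even rank to be dominated,
up to the factor [sqrt c], by the following terms of odd rank
([two_step_rec_ratio]).  Since [N] is even, the peak has even rank either
counted from the left or counted from the right; so [z_q] is controlled by
[z_(q-1)] or [z_(q+1)], and the flux identity yields [|z_q| <= c]
([two_step_rec_end]).  Altogether [a |w_k| <= c] for all [k], and the sum of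
[d_k |w_k|] is at most [1 + 2 c] ([column_bounds]).

The first bound is the estimate from l^1 to l^infty.  For the two others use the
first bound on the indices with [d_k <= a], of which there are at most
[1 + a ^ (1/2m)], and the second one on the remaining indices
([weighted_sum_le]); weights are handled through [l + k <= 3 d_k ^ (1/2m)].
Finally, the norms of a block-diagonal matrix are maxima over its blocks, and
all the powers of [a] involved have nonpositive exponents, so that the block
with [l = 1] gives the largest bound. *)

Set Implicit Arguments.
Unset Strict Implicit.

(** * A two-step recurrence without cancellation *)

Lemma normrD_ge0M (R : realDomainType) (x y : R) :
  0 <= x * y -> `|x + y| = `|x| + `|y|.
Proof. by case: (ger0P x); case: (ger0P y); case: (ger0P (x + y)); nra. Qed.

(** Both halves of a column of the inverse, read from the boundary towards the
peak at rank [n], are sequences of this kind. *)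
Definition two_step_rec (R : pzRingType) (n : nat) (e y : nat -> R) :=
  y 0%N = 0 /\
  forall k, (k.+1 < n)%N -> y k.+2 = y k + e k.+1 * y k.+1.

Section OneSided.
Variables (R : realDomainType) (n : nat) (e y : nat -> R).
Hypothesis e_ge0 : forall k, 0 <= e k.
Hypothesis yrec : two_step_rec n e y.

(** Multiplying the recurrence by [y k.+1] propagates the sign of the products
[y k * y k.+1].  Where [e] is positive, the quantitative form also shows that a
zero of [y] is preceded by a zero. *)
Lemma two_step_rec_prod k : (k < n)%N -> e k * y k ^+ 2 <= y k * y k.+1.
Proof.
case: yrec => y0 yS; elim: k => [|k IHk] kn.
  by rewrite y0 expr0n mulr0 mul0r.
rewrite yS//; have := IHk (ltnW kn).
have : 0 <= e k * y k ^+ 2 by rewrite mulr_ge0 ?sqr_ge0.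
nra.
Qed.

Lemma two_step_rec_prod_ge0 k : (k < n)%N -> 0 <= y k * y k.+1.
Proof.
by move=> /two_step_rec_prod; apply: le_trans; rewrite mulr_ge0 ?sqr_ge0.
Qed.

(** The two terms on the right of the recurrence have the same sign, so taking
absolute values loses nothing. *)
Lemma two_step_rec_norm : two_step_rec n e (fun k => `|y k|).
Proof.
have [y0 yS] := yrec; split=> [|k kn]; first by rewrite y0 normr0.
rewrite yS// -{2}(ger0_norm (e_ge0 k.+1)) -normrM normrD_ge0M// mulrCA.
by rewrite mulr_ge0 // two_step_rec_prod_ge0 // ltnW.
Qed.

Hypothesis y_ge0 : forall k, 0 <= y k.

(** [y] is nondecreasing in steps of two, so its last two terms bound it. *)
Lemma two_step_rec_le K k : y n <= K -> y n.-1 <= K -> (k <= n)%N -> y k <= K.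
Proof.
have [_ yS] := yrec => yn yn1 kn; rewrite -(subKn kn).
suff /(_ (n - k)%N) [] :
  forall i, y (n - i)%N <= K /\ y (n - i.+1)%N <= K by [].
elim=> [|i [IH1 IH2]]; first by rewrite subn0 subn1.
split=> //; have [ni|ni] := leqP n i.+1.
  by have <- : (n - i.+1 = n - i.+2)%N by lia.
apply: le_trans IH1.
have -> : (n - i = (n - i.+2).+2)%N by lia.
by rewrite yS ?lerDl ?mulr_ge0 //; lia.
Qed.

(** Each [e k * y k] equals [y k.+1 - y k.-1], and the sum telescopes. *)
Lemma two_step_rec_sum :
  \sum_(1 <= k < n) e k * y k <= y n + y n.-1.
Proof.
have [y0 yS] := yrec.
case: n yS => [|p]; first by move=> _; rewrite big_geq ?addr_ge0.
elim: p => [|p IHp] yS; first by rewrite big_geq ?addr_ge0.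
rewrite big_nat_recr //= yS //.
have := IHp (fun k kn => yS k (ltnW kn)); rewrite /=; lra.
Qed.

(** An invariant of the recurrence: starting from [y 0 <= B * y 1], which holds
as [y 0 = 0], two steps preserve the domination of an even term by the next odd
one, as long as [e] does not drop by a factor larger than [B ^+ 2]. *)
Lemma two_step_rec_ratio (B : R) i : 0 < B ->
  (forall k, (k.+1 < n)%N -> e k.+1 <= B ^+ 2 * e k.+2) ->
  (i.*2 < n)%N -> y i.*2 <= B * y i.*2.+1.
Proof.
have [y0 yS] := yrec => B0 eB.
elim: i => [|i IHi] iN; first by rewrite y0 mulr_ge0 // ltW.
have {}IHi := IHi (ltnW (ltnW iN)).
rewrite doubleS in iN *.
rewrite (yS i.*2.+1) // yS; last exact: ltnW.
have := eB _ (ltnW iN); have := y_ge0 i.*2; have := y_ge0 i.*2.+1.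
move: IHi (e_ge0 i.*2.+1).
move: (y i.*2) (y i.*2.+1) (e i.*2.+1) (e i.*2.+2) => t x f g tx f0 x0 t0 fg.
rewrite -(ler_pM2l B0).
have h : f * (t + f * x) <= B ^+ 2 * g * (t + f * x).
  by apply: ler_wpM2r => //; rewrite addr_ge0 // mulr_ge0.
(* This is affine in [t], so it follows from its cases [t = 0] and [t = B * x];
   the coefficient [B - f] of [t] decides which one is needed. *)
suff: B * t + B * f * x <= B ^+ 2 * x + f * t + f ^+ 2 * x by nra.
have [Bf|fB] := lerP B f.
  have : 0 <= (f - B) * t by rewrite mulr_ge0 // subr_ge0.
  have : 0 <= (f - B) * (f * x) by rewrite !mulr_ge0 // subr_ge0.
  have : 0 <= B ^+ 2 * x by rewrite mulr_ge0 // sqr_ge0.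
  nra.
have : 0 <= (B - f) * (B * x - t) by rewrite mulr_ge0 // subr_ge0 // ltW.
have : 0 <= f ^+ 2 * x by rewrite mulr_ge0 // sqr_ge0.
nra.
Qed.

(** At an even rank [n] the domination of even terms gives
[y n <= (B + e n.-1) * y n.-1], and [e n.-1 <= B ^+ 2 * e n].  If
[y n.-1 < y n], the right-hand side is at most
[B ^+ 2 * (y n.-1 + e n * y n)]. *)
Lemma two_step_rec_end (B : R) : 1 <= B -> (0 < n)%N -> ~~ odd n ->
  (forall k, (k.+1 < n)%N -> e k.+1 <= B ^+ 2 * e k.+2) ->
  e n * y n + y n.-1 <= 1 -> y n <= B ^+ 2.
Proof.
have [y0 yS] := yrec => B1 n0 n_even eB endn.
have B0 : 0 < B by apply: lt_le_trans B1.
have BB : B <= B ^+ 2 by rewrite expr2 ler_pMr.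
have fy : 0 <= e n * y n by rewrite mulr_ge0.
have [ynn1|ynn1] := lerP (y n) (y n.-1); first by lra.
have [i nE] : exists i, n = i.*2.+2.
  by exists n./2.-1; rewrite -doubleS prednK ?even_halfK //; lia.
have := @two_step_rec_ratio B i B0 eB; rewrite nE => /(_ (leqnSn _)) yi.
have eB' := eB i.*2; rewrite nE /= in eB' endn ynn1 fy.
have {eB'} := eB' (ltnSn _).
have := y_ge0 i.*2.+1; have := e_ge0 i.*2.+2; have := e_ge0 i.*2.+1.
have yE : y i.*2.+2 = y i.*2 + e i.*2.+1 * y i.*2.+1 by rewrite yS ?nE.
move=> e1 e2 y1 ee.
have h1 : e i.*2.+1 * y i.*2.+1 <= B ^+ 2 * (e i.*2.+2 * y i.*2.+2).
  apply: (@le_trans _ _ (B ^+ 2 * e i.*2.+2 * y i.*2.+1)).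
    by apply: ler_wpM2r.
  by rewrite -mulrA ler_wpM2l ?sqr_ge0// ler_wpM2l// ltW.
have h2 : B * y i.*2.+1 <= B ^+ 2 * y i.*2.+1 by apply: ler_wpM2r.
have : B ^+ 2 * (e i.*2.+2 * y i.*2.+2 + y i.*2.+1) <= B ^+ 2 * 1.
  by rewrite ler_wpM2l// sqr_ge0.
rewrite mulrDr mulr1; lra.
Qed.
End OneSided.

(** * Columns of the inverse of the tridiagonal matrix *)

(* Multiplying a column by the off-diagonal entry and dividing the diagonal by it
   removes that entry from the equations: [x] and [d] are so normalized. *)
Section Green.
Variables (R : rcfType) (N q : nat) (c : R) (d x : nat -> R).
Hypotheses (c1 : 1 <= c) (d_gt0 : forall k, 0 < d k).
Hypothesis d_growth : forall k, (0 < k)%N -> d k <= d k.+1 <= c * d k.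
Hypotheses (N_even : ~~ odd N) (qN : (0 < q <= N)%N).
Hypotheses (x0 : x 0%N = 0) (xN : x N.+1 = 0).
Hypothesis xeq : forall k, (k < N)%N ->
  d k.+1 * x k.+1 - x k.+2 + x k = (k.+1 == q)%:R.

(* Reading the column backwards from [N.+1] exchanges the two off-diagonals; the
   alternating sign restores the sign pattern of the recurrence. *)
Let d' k := d (N.+1 - k)%N.
Let x' k : R := (-1) ^+ k * x (N.+1 - k)%N.

Let d_ge0 k : 0 <= d k. Proof. exact/ltW. Qed.
Let d'_ge0 k : 0 <= d' k. Proof. exact/ltW/d_gt0. Qed.

Lemma green_left : two_step_rec q d x.
Proof.
split=> // k kq; have := @xeq k; rewrite ltn_eqF// mulr0n => xk.
have {xk} := xk ltac:(lia); lra.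
Qed.

Lemma green_right : two_step_rec (N.+1 - q) d' x'.
Proof.
split=> [|k kq]; first by rewrite /x' subn0 xN mulr0.
rewrite /x' /d'; have := @xeq (N.+1 - k.+2)%N.
have -> : (N.+1 - k = (N.+1 - k.+2).+2)%N by lia.
have -> : (N.+1 - k.+1 = (N.+1 - k.+2).+1)%N by lia.
rewrite gtn_eqF ?mulr0n; last by lia.
move=> xk; have {}xk := xk ltac:(lia).
rewrite !exprS.
have -> : x (N.+1 - k.+2)%N =
    x (N.+1 - k.+2).+2 - d (N.+1 - k.+2).+1 * x (N.+1 - k.+2).+1.
  by lra.
ring.
Qed.

Let normx' k : `|x' k| = `|x (N.+1 - k)%N|.
Proof. by rewrite normrM normrX normrN1 expr1n mul1r. Qed.

(** The equation at the peak: [x q.-1] has the sign of [x q] and [x q.+1] the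
opposite one, so the left-hand side is a sum of absolute values up to a global
sign, which is that of the right-hand side. *)
Lemma green_flux : d q * `|x q| + `|x q.-1| + `|x q.+1| = 1.
Proof.
have [q0 qN'] := andP qN.
have := @xeq q.-1; rewrite prednK// eqxx mulr1n => /(_ qN') xq.
have := two_step_rec_prod d_ge0 green_left (k := q.-1).
rewrite prednK// leqnn => /(_ isT) pl.
have Nq : (N - q < N.+1 - q)%N by lia.
have := two_step_rec_prod d'_ge0 green_right Nq.
rewrite /x' /d' subSS.
have -> : (N.+1 - (N - q) = q.+1)%N by lia.
rewrite subKn// [(-1) ^+ _.+1]exprS mulN1r exprMn sqrr_sign mul1r => pr.
have {}pr : d q.+1 * x q.+1 ^+ 2 <= - (x q.+1 * x q).
  apply: le_trans pr _; rewrite mulrACA mulrN -expr2 sqrr_sign.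
  lra.
have Dl : 0 <= d q.-1 * x q.-1 ^+ 2 by rewrite mulr_ge0 ?sqr_ge0.
have Dr : 0 <= d q.+1 * x q.+1 ^+ 2 by rewrite mulr_ge0 ?sqr_ge0.
have := d_gt0 q; move: (d_gt0 q.-1) (d_gt0 q.+1).
move: pl pr Dl Dr xq.
move: (x q) (x q.-1) (x q.+1) (d q) (d q.-1) (d q.+1).
move=> u v w f g h pl pr Dl Dr E g0 h0 f0.
have uv : 0 <= v * u by exact: le_trans pl.
have uw : w * u <= 0 by rewrite -oppr_ge0; exact: le_trans pr.
have [u0|u0|u0] := ltrgt0P u.
- move: uv uw; rewrite pmulr_lge0// pmulr_lle0// => v0 w0.
  by rewrite (ger0_norm v0) (ler0_norm w0); lra.
- move: uv uw; rewrite nmulr_lge0// nmulr_lle0// => v0 w0.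
  have : f * u <= 0 by rewrite pmulr_rle0// ltW.
  lra.
(* If the peak vanished, so would its neighbours, against the equation. *)
- have /eqP : g * v ^+ 2 = 0.
    by apply: le_anti; rewrite Dl u0 mulr0 in pl *; lra.
  rewrite mulf_eq0 gt_eqF//= expf_eq0/= => /eqP v0.
  have /eqP : h * w ^+ 2 = 0.
    by apply: le_anti; rewrite Dr u0 mulr0 in pr *; lra.
  rewrite mulf_eq0 gt_eqF//= expf_eq0/= => /eqP w0.
  by move: E; rewrite u0 v0 w0; lra.
Qed.

(** As [N] is even, one of [q] and [N.+1 - q] is even: [two_step_rec_end]
applies from the left in the first case and from the right in the second. *)
Lemma green_peak : `|x q| <= c.
Proof.
have c0 : 0 <= c by apply: le_trans c1.
have [q0 qN'] := andP qN.
have B1 : 1 <= Num.sqrt c by rewrite -sqrtr1 ler_wsqrtr.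
rewrite -(sqr_sqrtr c0).
have flux := green_flux.
have [q_even|q_odd] := boolP (~~ odd q).
  apply: (two_step_rec_end d_ge0 (two_step_rec_norm d_ge0 green_left)) => //.
    rewrite sqr_sqrtr// => k kq; have /andP[h1 _] := d_growth (ltn0Sn k).
    by apply: (le_trans h1); rewrite ler_peMl.
  by have := normr_ge0 (x q.+1); lra.
have qE : (N.+1 - (N.+1 - q) = q)%N by lia.
rewrite -{1}qE -normx'.
apply: (two_step_rec_end d'_ge0 (two_step_rec_norm d'_ge0 green_right)) => //;
  rewrite ?subn_gt0 ?ltnS//.
- by lia.
- rewrite sqr_sqrtr// => k kq; rewrite /d'.
  have -> : (N.+1 - k.+1 = (N.+1 - k.+2).+1)%N by lia.
  by have /andP[] := @d_growth (N.+1 - k.+2)%N ltac:(lia).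
- rewrite !normx' /d' qE.
  have -> : (N.+1 - (N.+1 - q).-1 = q.+1)%N by lia.
  by have := normr_ge0 (x q.-1); lra.
Qed.

Lemma green_sup k : (k <= N)%N -> `|x k| <= c.
Proof.
have [q0 qN'] := andP qN.
have flux := green_flux; have dq : 0 <= d q * `|x q| by rewrite mulr_ge0.
have := normr_ge0 (x q.+1); have := normr_ge0 (x q.-1) => xl xr kN.
have [kq|qk] := leqP k q.
  apply: (two_step_rec_le d_ge0 (two_step_rec_norm d_ge0 green_left)) kq => //.
    exact: green_peak.
  apply: le_trans c1; lra.
have -> : k = (N.+1 - (N.+1 - k))%N by lia.
rewrite -normx'.
apply: (two_step_rec_le d'_ge0 (two_step_rec_norm d'_ge0 green_right)) => //;
  rewrite ?normx'.
- have -> : (N.+1 - (N.+1 - q) = q)%N by lia.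
  exact: green_peak.
- have -> : (N.+1 - (N.+1 - q).-1 = q.+1)%N by lia.
  apply: le_trans c1; lra.
- by lia.
Qed.

Lemma green_sum : \sum_(1 <= k < N.+1) d k * `|x k| <= 1 + 2 * c.
Proof.
have [q0 qN'] := andP qN.
have flux := green_flux; have peak := green_peak.
rewrite (@big_cat_nat _ _ _ q)//= ?ltnS//; last exact: leqW.
rewrite (@big_cat_nat _ _ _ q.+1 q)//= big_nat1.
have := two_step_rec_sum (two_step_rec_norm d_ge0 green_left)
  (fun=> normr_ge0 _).
have := two_step_rec_sum (two_step_rec_norm d'_ge0 green_right)
  (fun=> normr_ge0 _).
rewrite !normx'.
have -> : (N.+1 - (N.+1 - q) = q)%N by lia.
have -> : (N.+1 - (N.+1 - q).-1 = q.+1)%N by lia.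
have -> : \sum_(1 <= k < N.+1 - q) d' k * `|x' k| =
    \sum_(q.+1 <= k < N.+1) d k * `|x k|.
  rewrite [RHS]big_nat_rev/= -{1}[q.+1]add1n big_addn.
  apply: eq_big_nat => k kq; rewrite normx' /d'.
  by have -> : (q.+1 + N.+1 - (k + q).+1 = N.+1 - k)%N by lia.
lra.
Qed.
End Green.

(** * Weighted sums against the diagonal *)

Lemma powR_antitone (R : realType) (x y e : R) :
  0 < x -> x <= y -> e <= 0 -> y `^ e <= x `^ e.
Proof.
move=> x0 xy e0; have y0 := lt_le_trans x0 xy.
rewrite -[e]opprK ![_ `^ (- - e)]powRN lef_pV2 ?posrE ?powR_gt0//.
by rewrite ge0_ler_powR ?nnegrE ?oppr_ge0// ltW.
Qed.

Section Weights.
Variables (R : realType) (m : R) (l : nat).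
Hypotheses (m1 : 1 < m) (l0 : (0 < l)%N).

Definition Ldiag (k : nat) : R := l%:R `^ (2 * m) + k%:R `^ (2 * m).

Let m0 : 0 < m. Proof. exact: lt_trans m1. Qed.
Let mm : 0 < 2 * m. Proof. by rewrite mulr_gt0. Qed.

Lemma powR2m_ge1 (x : R) : 1 <= x -> 1 <= x `^ (2 * m).
Proof. by move=> x1; rewrite -[leLHS](powRr0 x) ler_powR// ltW. Qed.

Lemma Ldiag_ge1 k : 1 <= Ldiag k.
Proof. by rewrite /Ldiag ler_wpDr ?powR_ge0// powR2m_ge1// ler1n. Qed.

Lemma Ldiag_gt0 k : 0 < Ldiag k.
Proof. exact: lt_le_trans (Ldiag_ge1 k). Qed.

(** For the upper bound, [k.+2 <= 2 * k.+1] settles all steps but the first, where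
the summand [1] replaces [0] and is absorbed by [l%:R `^ (2 * m)]. *)
Lemma Ldiag_growth k : Ldiag k <= Ldiag k.+1 <= 2 `^ (2 * m) * Ldiag k.
Proof.
rewrite /Ldiag; apply/andP; split.
  by rewrite lerD2l ge0_ler_powR ?nnegrE ?ler0n ?ler_nat// ltW.
have c2 : 2 <= 2 `^ (2 * m) :> R.
  by rewrite -{1}(powRr1 (ler0n R 2)) ler_powR ?ler1n//; have := m1; lra.
have L1 : 1 <= l%:R `^ (2 * m) by rewrite powR2m_ge1// ler1n.
case: k => [|k].
  rewrite powR1 powR0 ?gt_eqF// addr0.
  have : 2 * l%:R `^ (2 * m) <= 2 `^ (2 * m) * l%:R `^ (2 * m).
    by rewrite ler_wpM2r// powR_ge0.
  lra.
rewrite mulrDr lerD//.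
  by rewrite ler_peMl ?powR_ge0//; lra.
rewrite -powRM// ge0_ler_powR ?nnegrE// ?(ltW mm)//.
by rewrite -natrM ler_nat; lia.
Qed.

Lemma le_Ldiag_root k (t : R) : Ldiag k <= t -> k%:R <= t `^ (1 / (2 * m)).
Proof.
move=> kt; have t0 : 0 <= t by apply: le_trans kt; exact/ltW/Ldiag_gt0.
have p0 : 0 <= 1 / (2 * m) by rewrite divr_ge0// ltW.
have <- : (k%:R `^ (2 * m)) `^ (1 / (2 * m)) = k%:R :> R.
  by rewrite -powRrM mulrC divfK ?gt_eqF// powRr1.
rewrite ge0_ler_powR ?nnegrE ?powR_ge0//.
by apply: le_trans kt; rewrite /Ldiag lerDr powR_ge0.
Qed.

(** Both [l] and [k] are at most [Ldiag k `^ (1 / (2 * m))], and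
[l + k.+1 <= 2 * l + k]. *)
Lemma gradient_weight_le k :
  (l + k.+1)%:R <= 3 * Ldiag k `^ (1 / (2 * m)).
Proof.
have p0 : 0 <= 1 / (2 * m) by rewrite divr_ge0// ltW.
have hk := @le_Ldiag_root k _ (lexx _).
have hl : l%:R <= Ldiag k `^ (1 / (2 * m)).
  have <- : (l%:R `^ (2 * m)) `^ (1 / (2 * m)) = l%:R :> R.
    by rewrite -powRrM mulrC divfK ?gt_eqF// powRr1.
  rewrite ge0_ler_powR ?nnegrE ?powR_ge0// ?(ltW (Ldiag_gt0 k))//.
  by rewrite /Ldiag lerDl powR_ge0.
have : 1 <= l%:R :> R by rewrite ler1n.
rewrite -addn1 !natrD; lra.
Qed.

Lemma count_le_real (t : R) N : 0 <= t ->
  \sum_(k < N) ((k%:R <= t)%R : nat)%:R <= t + 1.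
Proof.
move=> t0; elim: N => [|N IHN]; first by rewrite big_ord0 addr_ge0.
rewrite big_ord_recr/=; have [Nt|_] := lerP N%:R t; last by rewrite addr0.
rewrite lerD2r; apply: le_trans Nt.
rewrite -[N in N%:R]card_ord -sumr_const ler_sum// => k _.
by rewrite lern1; case: (_ <= t).
Qed.

(** For [1 <= a], compare [D `^ th * u] with [a `^ (th - 1)] times [c] when
[D <= a] and times [D * u] otherwise; the first case occurs for at most
[a `^ (1 / (2 * m)) + 1] indices, a number that is at most
[2 * a `^ (1 / (2 * m))].  For [a < 1] the power of [a] is at least [1], and
[D `^ th <= D] suffices since [1 <= D]. *)
Lemma weighted_sum_le (a c M th : R) N (u : 'I_N -> R) :
  0 < a -> 0 <= c -> 0 <= M -> 0 <= th -> th + 1 / (2 * m) <= 1 ->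
  (forall k, 0 <= u k) -> (forall k, a * u k <= c) ->
  \sum_(k < N) Ldiag k * u k <= M ->
  \sum_(k < N) Ldiag k `^ th * u k <=
    (2 * c + M) * a `^ (- 1 + 1 / (2 * m) + th).
Proof.
set p := 1 / (2 * m) => a0 c0 M0 th0 thp u0 uc uM.
have p0 : 0 < p by rewrite divr_gt0.
have th1 : th <= 1 by apply: le_trans thp; rewrite lerDl ltW.
have e0 : - 1 + p + th <= 0 by rewrite -addrA addrC subr_le0 addrC.
have [a1|a1] := ltrP a 1.
  apply: (@le_trans _ _ M).
    apply: le_trans uM; apply: ler_sum => k _; apply: ler_wpM2r => //.
    by rewrite -[leRHS]powRr1 ?ler_powR ?Ldiag_ge1// ?(ltW (Ldiag_gt0 _)).
  apply: (@le_trans _ _ (2 * c + M)); first by rewrite lerDr mulr_ge0.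
  rewrite ler_peMr ?addr_ge0 ?mulr_ge0//.
  by rewrite -[leLHS](powRr0 a) ger_powR// a0 ltW.
have aE : a `^ (- 1 + p + th) = a `^ (th - 1) * a `^ p.
  rewrite -powRD ?(gt_eqF a0) ?implybT//.
  by congr (a `^ _); rewrite addrC addrA.
have ap1 : 1 <= a `^ p by rewrite -[leLHS](powRr0 a) ler_powR// ltW.
have term k : Ldiag (k : 'I_N) `^ th * u k <=
    a `^ (th - 1) * (c * ((k%:R <= a `^ p)%R : nat)%:R + Ldiag k * u k).
  have [Da|aD] := lerP (Ldiag k) a.
    rewrite (le_Ldiag_root Da) mulr1.
    apply: (@le_trans _ _ (a `^ (th - 1) * c)); last first.
      by rewrite ler_wpM2l ?powR_ge0// lerDl mulr_ge0// ltW// Ldiag_gt0.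
    apply: (@le_trans _ _ (a `^ (th - 1) * (a * u k))); last first.
      by rewrite ler_wpM2l ?powR_ge0.
    rewrite mulrA ler_wpM2r// powRD ?(gt_eqF a0) ?implybT//.
    rewrite powR_inv1 ?(ltW a0)//.
    rewrite mulfVK ?gt_eqF//.
    by rewrite ge0_ler_powR ?nnegrE ?(ltW a0)// ltW// Ldiag_gt0.
  apply: (@le_trans _ _ (a `^ (th - 1) * (Ldiag k * u k))); last first.
    by rewrite ler_wpM2l ?powR_ge0// lerDr mulr_ge0// ltW// ltr0n.
  rewrite mulrA ler_wpM2r//.
  have -> : Ldiag k `^ th = Ldiag k `^ (th - 1) * Ldiag k.
    rewrite powRD ?(gt_eqF (Ldiag_gt0 _)) ?implybT//.
    rewrite powR_inv1 ?ltW ?Ldiag_gt0//.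
    by rewrite mulfVK ?gt_eqF ?Ldiag_gt0.
  rewrite ler_wpM2r ?(ltW (Ldiag_gt0 k))//.
  by rewrite powR_antitone ?(ltW aD) ?subr_le0.
apply: le_trans (ler_sum _ (fun k _ => term k)) _.
rewrite -mulr_sumr big_split/= -mulr_sumr aE [leRHS]mulrCA.
rewrite ler_wpM2l ?powR_ge0//.
have h := count_le_real N (powR_ge0 a p).
have : c * \sum_(k < N) ((k%:R <= a `^ p)%R : nat)%:R <= c * (a `^ p + 1).
  by rewrite ler_wpM2l.
have : c <= c * a `^ p by rewrite ler_peMr.
have : M <= M * a `^ p by rewrite ler_peMr.
lra.
Qed.
End Weights.

(** * Block-diagonal matrices *)

Section Blocks.
Variables (R : realType) (N : nat).

Lemma invmx_mxdiag (p_ : 'I_N -> nat) (B : forall i, 'M[R]_(p_ i)) :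
  (forall i, B i \in unitmx) ->
  invmx (\mxdiag_i B i) = \mxdiag_i invmx (B i).
Proof.
move=> Bu.
have BV : \mxdiag_i B i *m \mxdiag_i invmx (B i) = 1%:M.
  rewrite {2}/mxdiag mul_mxdiag_mxblock -mxdiagZ; apply/eq_mxblockP => i j.
  case: eqVneq => [<-|_]; last by rewrite mulmx0.
  by rewrite !conform_mx_id mulmxV.
have [Du _] := mulmx1_unit BV.
by rewrite -[LHS]mulmx1 -BV mulmxA mulVmx// mul1mx.
Qed.

Lemma mxdiag_Rank (p_ : 'I_N -> nat) (B : forall i, 'M[R]_(p_ i)) i i' j j' :
  (\mxdiag_i B i) (tagnat.Rank i j) (tagnat.Rank i' j') =
    submxblock (\mxdiag_i B i) i i' j j'.
Proof. by rewrite [RHS]mxE. Qed.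

Lemma norm_l1_l1_mxdiag (B : 'I_N -> 'M[R]_N) K : 0 <= K ->
  (forall i, norm_l1_l1 (B i) <= K) -> norm_l1_l1 (\mxdiag_i B i) <= K.
Proof.
move=> K0 BK; apply: bigmax_le => // s _.
rewrite -[s]tagnat.sig2K; move: (tagnat.sig1 s) (tagnat.sig2 s) => i j.
apply: le_trans (BK i).
apply: le_trans (le_bigmax _ _ j).
have -> : \sum_s `|(\mxdiag_i B i) s (tagnat.Rank i j)| =
    \sum_(i' < N) \sum_(k < N)
      `|(\mxdiag_i B i) (tagnat.Rank i' k) (tagnat.Rank i j)|.
  rewrite sig_big_dep (reindex _ tagnat.sig_bij_on) /=.
  by apply: eq_bigr => t _; rewrite tagnat.sig2K.
rewrite (bigD1 i)//= [X in _ + X]big1 => [|i' i'i].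
  rewrite addr0 le_eqVlt; apply/orP; left; apply/eqP/eq_bigr => k _.
  by rewrite mxdiag_Rank submxblock_diag.
apply: big1 => k _.
by rewrite mxdiag_Rank mxblockK (negbTE i'i) mxE normr0.
Qed.

Lemma norm_l1_linfty_mxdiag (B : 'I_N -> 'M[R]_N) K : 0 <= K ->
  (forall i, norm_l1_linfty (B i) <= K) -> norm_l1_linfty (\mxdiag_i B i) <= K.
Proof.
move=> K0 BK; apply: bigmax_le => // s _; apply: bigmax_le => // t _.
rewrite -[s]tagnat.sig2K -[t]tagnat.sig2K.
move: (tagnat.sig1 s) (tagnat.sig2 s) => i j.
move: (tagnat.sig1 t) (tagnat.sig2 t) => i' j'.
rewrite mxdiag_Rank; have [ii'|i'i] := eqVneq i' i.
  case: _ / ii' in j *; rewrite submxblock_diag.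
  apply: le_trans (BK i').
  apply: le_trans (le_bigmax _ _ j).
  by apply: (le_trans _ (le_bigmax _ _ j')).
by rewrite mxblockK (negbTE i'i) mxE normr0.
Qed.

Lemma norm_l1_l11_mxdiag (B : 'I_N -> 'M[R]_N) K : 0 <= K ->
  (forall i : 'I_N, norm_l1_l11_block i.+1 (B i) <= K) ->
  norm_l1_l11 (\mxdiag_i B i) <= K.
Proof.
by move=> K0 BK; apply: bigmax_le => // i _; rewrite submxblock_diag.
Qed.
End Blocks.

(** * The blocks of the truncated operator *)

Section Column.
Variables (R : realType) (m lambda : R) (N l : nat).
Hypotheses (m1 : 1 < m) (la0 : 0 < lambda) (l0 : (0 < l)%N) (N_even : ~~ odd N).
Let a := l%:R * lambda / 2.
Let c : R := 2 `^ (2 * m).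
Let A := invmx (Lblock N m lambda l).

Let a0 : 0 < a. Proof. by rewrite divr_gt0 ?mulr_gt0 ?ltr0n. Qed.

(** Column [j] of the inverse with indices shifted by one, so that its entries
lie at [1], ..., [N] and the empty sum provides the zero values at [0] and
[N.+1]. *)
Definition padded_col (j : 'I_N) (k : nat) : R :=
  \sum_(i < N | i.+1 == k) A i j.

Lemma padded_colS j (i : 'I_N) : padded_col j i.+1 = A i j.
Proof. exact: big_pred1. Qed.

Lemma padded_col_eq j (i : 'I_N) :
  Ldiag m l i * padded_col j i.+1 - a * padded_col j i.+2
    + a * padded_col j i = (i == j)%:R.
Proof.
have /matrixP/(_ i j) := mulmxV (Lblock_unitmx N m lambda l0).
rewrite !mxE => <-.
rewrite /padded_col !mulr_sumr !(big_mkcond (fun i0 : 'I_N => _ == _)) /=.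
rewrite -sumrB -big_split /=.
apply: eq_bigr => k _; rewrite mxE /a /Ldiag eqSS (eq_sym (k : nat)).
rewrite eqSS.
have [->|ik] := eqVneq (i : nat) k.
  by rewrite ltn_eqF// gtn_eqF// subr0 addr0.
have [->|ki] := eqVneq (k : nat) i.+1.
  by rewrite gtn_eqF// sub0r addr0 mulNr.
rewrite subr0 add0r eq_sym.
by case: eqP => //; rewrite mul0r.
Qed.

Lemma column_bounds j :
  (forall k, a * `|A k j| <= c) /\
  \sum_(k < N) Ldiag m l k * `|A k j| <= 1 + 2 * c.
Proof.
pose d k := Ldiag m l k.-1 / a.
pose x k := a * padded_col j k.
have c1 : 1 <= c.
  by apply: powR2m_ge1 => //; rewrite ler1n.
have d_gt0 k : 0 < d k by rewrite divr_gt0// Ldiag_gt0.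
have d_growth k : (0 < k)%N -> d k <= d k.+1 <= c * d k.
  case: k => // k _; rewrite /d /= mulrA !ler_pM2r ?invr_gt0//.
  exact: Ldiag_growth.
have x0 : x 0%N = 0 by rewrite /x /padded_col big_pred0 ?mulr0.
have xN : x N.+1 = 0.
  by rewrite /x /padded_col big_pred0 ?mulr0// => i; rewrite eqSS ltn_eqF.
have jN : (0 < j.+1 <= N)%N by exact: ltn_ord.
have xeq k : (k < N)%N -> d k.+1 * x k.+1 - x k.+2 + x k = (k.+1 == j.+1)%:R.
  move=> kN; rewrite eqSS -[(k == j)]/(Ordinal kN == j) -padded_col_eq /d /x /=.
  by rewrite mulrA divfK ?gt_eqF.
have normx (k : 'I_N) : `|x k.+1| = a * `|A k j|.
  by rewrite normrM gtr0_norm// padded_colS.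
split=> [k|].
  by rewrite -normx; apply: (green_sup c1 d_gt0 d_growth N_even jN x0 xN xeq).
apply: le_trans (green_sum c1 d_gt0 d_growth N_even jN x0 xN xeq).
rewrite big_add1 /= big_mkord; apply: ler_sum => k _.
by rewrite normx /d /= mulrA divfK ?gt_eqF.
Qed.

(** The common source of the l^1 bound ([th = 0]) and of the gradient bound
([th = 1 / (2 * m)]). *)
Lemma block_weighted (th : R) j : 0 <= th -> th + 1 / (2 * m) <= 1 ->
  \sum_(k < N) Ldiag m l k `^ th * `|A k j| <=
    (1 + 4 * c) * a `^ (- 1 + 1 / (2 * m) + th).
Proof.
move=> th0 thp; have [sup sum] := column_bounds j.
have c0 : 0 <= c by exact: powR_ge0.
have -> : 1 + 4 * c = 2 * c + (1 + 2 * c) by ring.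
apply: weighted_sum_le => //; rewrite ?addr_ge0 ?mulr_ge0//.
Qed.

Let half_lt : 1 / (2 * m) <= 1 / 2.
Proof. by rewrite !mul1r lef_pV2 ?posrE//; have := m1; lra. Qed.

Lemma block_l1_l1 : norm_l1_l1 A <= (1 + 4 * c) * a `^ (- 1 + 1 / (2 * m)).
Proof.
have K0 : 0 <= (1 + 4 * c) * a `^ (- 1 + 1 / (2 * m)).
  by rewrite mulr_ge0 ?addr_ge0 ?mulr_ge0 ?powR_ge0.
apply: bigmax_le => // j _.
have := block_weighted j (lexx 0); rewrite add0r addr0.
under eq_bigr do rewrite powRr0 mul1r.
by apply; apply: le_trans half_lt _; lra.
Qed.

Lemma block_l1_linfty : norm_l1_linfty A <= c * a^-1.
Proof.
have K0 : 0 <= c * a^-1 by rewrite mulr_ge0 ?powR_ge0 ?invr_ge0 ?ltW.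
apply: bigmax_le => // j _; apply: bigmax_le => // k _.
by rewrite ler_pdivlMr// mulrC; have [] := column_bounds j.
Qed.

Lemma block_l1_l11 :
  norm_l1_l11_block l A <= 3 * (1 + 4 * c) * a `^ (- 1 + 1 / m).
Proof.
have K0 : 0 <= 3 * (1 + 4 * c) * a `^ (- 1 + 1 / m).
  by rewrite !mulr_ge0 ?addr_ge0 ?mulr_ge0 ?powR_ge0.
apply: bigmax_le => // j _.
have p0 : 0 <= 1 / (2 * m).
  by rewrite divr_ge0// mulr_ge0// ltW// (lt_trans _ m1).
have pp : 1 / m = 1 / (2 * m) + 1 / (2 * m).
  by field; rewrite gt_eqF// (lt_trans _ m1).
have h : 1 / (2 * m) + 1 / (2 * m) <= 1.
  by apply: le_trans (lerD half_lt half_lt) _; lra.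
rewrite pp addrA -mulrA.
apply: (@le_trans _ _
    (3 * \sum_(k < N) Ldiag m l k `^ (1 / (2 * m)) * `|A k j|)); last first.
  by rewrite ler_wpM2l// block_weighted.
rewrite mulr_sumr; apply: ler_sum => k _; rewrite mulrA ler_wpM2r//.
exact: gradient_weight_le.
Qed.
End Column.

Unset Implicit Arguments.

Theorem theorem4p11 (R : realType) (m : R) (hm : 1 < m) :
  exists C1 C2 : R, [/\ 0 < C1, 0 < C2 &
    forall (N : nat) (lambda : R), (0 < N)%N -> ~~ odd N -> 0 < lambda ->
      (forall l : nat, (1 <= l <= N)%N ->
        [/\ norm_l1_l1 (invmx (Lblock N m lambda l))
              <= C1 * (l%:R * lambda / 2) `^ (- 1 + 1 / (2 * m)),
            norm_l1_linfty (invmx (Lblock N m lambda l))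
              <= 2 `^ (2 * m) * (l%:R * lambda / 2)^-1
          & norm_l1_l11_block l (invmx (Lblock N m lambda l))
              <= C2 * (l%:R * lambda / 2) `^ (- 1 + 1 / m)]) /\
      [/\ norm_l1_l1 (invmx (LR N m lambda))
            <= C1 * (lambda / 2) `^ (- 1 + 1 / (2 * m)),
          norm_l1_linfty (invmx (LR N m lambda))
            <= 2 `^ (2 * m) * (lambda / 2)^-1
        & norm_l1_l11 (invmx (LR N m lambda))
            <= C2 * (lambda / 2) `^ (- 1 + 1 / m)]].
Proof.
have m0 : 0 < m by exact: lt_trans hm.
have c0 : 0 <= 2 `^ (2 * m) :> R by exact: powR_ge0.
(* With [c = 2 `^ (2 * m)], [1 + 4 * c] is [2 * c + M] for the bound
   [M = 1 + 2 * c] of [column_bounds]; [3] comes from [gradient_weight_le]. *)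
exists (1 + 4 * 2 `^ (2 * m)), (3 * (1 + 4 * 2 `^ (2 * m))).
have C0 : 0 < 1 + 4 * 2 `^ (2 * m) :> R by lra.
split=> [//||N lambda N0 N_even la0]; first by rewrite mulr_gt0.
split=> [l /andP[l0 _]|].
  by split; [exact: block_l1_l1|exact: block_l1_linfty|exact: block_l1_l11].
have la2 : 0 < lambda / 2 by rewrite divr_gt0.
have la_le (l : 'I_N) : lambda / 2 <= l.+1%:R * lambda / 2.
  by rewrite -mulrA ler_peMl ?ler1n// ltW.
have e1 : - 1 + 1 / m <= 0.
  by rewrite addrC subr_le0 div1r invf_le1// ltW.
have e2 : - 1 + 1 / (2 * m) <= 0.
  by rewrite addrC subr_le0 div1r invf_le1 ?mulr_gt0//; lra.
rewrite /LR invmx_mxdiag => [|l]; last exact: Lblock_unitmx.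
split.
- apply: norm_l1_l1_mxdiag => [|l].
    by rewrite mulr_ge0 ?powR_ge0 ?(ltW C0).
  apply: le_trans (block_l1_l1 hm la0 (ltn0Sn l) N_even) _.
  by rewrite ler_pM2l// powR_antitone.
- apply: norm_l1_linfty_mxdiag => [|l].
    by rewrite mulr_ge0 ?invr_ge0 ?(ltW la2).
  apply: le_trans (block_l1_linfty hm la0 (ltn0Sn l) N_even) _.
  by rewrite ler_wpM2l// lef_pV2 ?posrE// (lt_le_trans la2).
- apply: norm_l1_l11_mxdiag => [|l].
    by rewrite !mulr_ge0 ?powR_ge0 ?(ltW C0).
  apply: le_trans (block_l1_l11 hm la0 (ltn0Sn l) N_even) _.
  by rewrite ler_pM2l ?mulr_gt0// powR_antitone.
Qed.
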